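(* Let $\mathcal{G}_{\mathrm{out}}$ be the class of all influence graphs $G=(V,E,p)$ that are out-arborescences. Then, for the influence maximization problem in the independent cascade model with full-adoption feedback, $$\sup_{G\in\mathcal{G}_{\mathrm{out}},\,k\ge 1}\frac{\mathrm{OPT}_A(G,k)}{\mathrm{OPT}_N(G,k)}\le 2.$$
   Context: Independent cascade (IC) model: an influence graph is a directed graph $G=(V,E,p)$ with $|V|=n$ and a probability $p_{uv}\in[0,1]$ on each edge $(u,v)\in E$. A live-edge graph (realization) $\phi$ is a random subgraph of $G$ on $V$ in which each edge $(u,v)$ is present (''live'') independently with probability $p_{uv}$; $\mathcal{P}$ denotes this distribution. For $S\subseteq V$, $\Gamma(S,\phi)$ is the set of nodes reachable from $S$ in $\phi$, and $\sigma(S)=\mathbb{E}_{\Phi\sim\mathcal{P}}[|\Gamma(S,\Phi)|]$. Full-adoption feedback: when a node $u$ is selected as a seed, one observes the live/blocked status of all out-going edges of every node reachable from $u$ in the realization. A partial realization $\psi$ records the seeds selected so far together with their observed feedback. An adaptive policy $\pi$ maps partial realizations to the next node to select; $V(\pi,\phi)$ is the seed set it selects under realization $\phi$, and $\sigma(\pi)=\mathbb{E}_{\Phi\sim\mathcal{P}}[|\Gamma(V(\pi,\Phi),\Phi)|]$. $\Pi(k)$ is the set of policies with $|V(\pi,\phi)|\le k$ for every realization $\phi$. $\mathrm{OPT}_N(G,k)=\max_{S\subseteq V,|S|\le k}\sigma(S)$ and $\mathrm{OPT}_A(G,k)=\sup_{\pi\in\Pi(k)}\sigma(\pi)$. An out-arborescence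 is an influence graph whose underlying graph is a directed tree with a root $r$ such that for every node $v$ the unique path between $r$ and $v$ is directed from $r$ to $v$. *)

(* Defs.v *)
From mathcomp Require Import all_boot all_order all_algebra.
Set Implicit Arguments. Unset Strict Implicit. Unset Printing Implicit Defensive.
Import Order.TTheory GRing.Theory Num.Theory.
Local Open Scope ring_scope.

Section IC.
Variables (R : realFieldType) (V : finType).

Implicit Types (E phi L : {set V * V}) (S : {set V}).

Definition out_arborescence E : Prop :=
  exists r : V,
    [/\ forall u, (u, r) \notin E,
        forall v, v != r -> #|[set u | (u, v) \in E]| = 1%N
      & forall v, connect [rel x y | (x, y) \in E] r v].

(* Probability of the live-edge graph phi (phi must be a subset of E). *)
Definition realization_prob E (p : V -> V -> R) phi : R :=
  \prod_(e in E) (if e \in phi then p e.1 e.2 else 1 - p e.1 e.2).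

Definition expect E (p : V -> V -> R) (f : {set V * V} -> R) : R :=
  \sum_(phi : {set V * V} | phi \subset E) realization_prob E p phi * f phi.

Definition reach S phi : {set V} :=
  [set v | [exists s in S, connect [rel x y | (x, y) \in phi] s v]].

Definition sigma E p S : R := expect E p (fun phi => #|reach S phi|%:R).

Definition OPT_N E p (k : nat) : R :=
  \big[Num.max/0]_(S : {set V} | (#|S| <= k)%N) sigma E p S.

(* Full-adoption feedback: after seeding S under realization phi, the
   statuses of all out-edges of every node of Gamma(S,phi) are observed.
   The partial realization is represented by the pair (S, L), where L is the
   set of observed live edges (the observed blocked edges are then the
   edges of E leaving reach S L = reach S phi that are not in L). *)
Definition observed_live S phi : {set V * V} :=
  [set e in phi | e.1 \in reach S phi].

(* An adaptive policy maps a partial realization (seeds, observed live edges)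
   to the next seed, or None to stop. *)
Definition policy := {set V} -> {set V * V} -> option V.

Definition policy_step (pi : policy) phi S : {set V} :=
  match pi S (observed_live S phi) with
  | Some v => v |: S
  | None => S
  end.

(* V(pi, phi): the seed set selected by pi under phi.  Each step either adds
   a new seed or reaches a fixpoint, so #|V| steps suffice. *)
Definition policy_seeds (pi : policy) phi : {set V} :=
  iter #|V| (policy_step pi phi) set0.

Definition policy_in (k : nat) E (pi : policy) : Prop :=
  forall phi, phi \subset E -> (#|policy_seeds pi phi| <= k)%N.

Definition sigma_pol E p (pi : policy) : R :=
  expect E p (fun phi => #|reach (policy_seeds pi phi) phi|%:R).

End IC.

(* Main.v *)
(** Fix a policy and let [x v] be the probability that it seeds [v].  Whether
    the parent [u] of [v] is reached does not depend on the status of the edge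
    [(u, v)], so the probability [P v] that [v] is reached satisfies
    [P v <= min 1 (x v + p u v * P u)].  If every node [v] is instead seeded
    independently with probability [x v], then [v] is reached with probability
    [F v = x v + (1 - x v) * p u v * F u], and [P <= 2 F] follows by induction
    from the root.  Since [\sum_v F v] is convex in [x] along the directions
    [e_u - e_v] and affine in each coordinate, pipage rounding turns [x], whose
    coordinates sum to at most [k], into a set of at most [k] seeds without
    decreasing this sum. *)

Require Import Defs.
From mathcomp Require Import all_boot all_order all_algebra.
From mathcomp Require Import ring lra.
Import Order.TTheory GRing.Theory Num.Theory.
Local Open Scope ring_scope.
Set Implicit Arguments. Unset Strict Implicit. Unset Printing Implicit Defensive.

(** * Pipage rounding of a point of the unit cube *)

Section PipageRounding.
Variables (R : realFieldType) (V : finType).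
Implicit Types (x y : V -> R) (s : seq V).

(** Convexity is encoded as an explicit quadratic: purely algebraic, and stable under sums. *)
Definition quad_convex (g : R -> R) :=
  exists B C : R, 0 <= C /\ forall t, g t = g 0 + t * B + t ^+ 2 * C.

Lemma quad_convex_sum (I : finType) (g : I -> R -> R) :
  (forall i, quad_convex (g i)) -> quad_convex (fun t => \sum_i g i t).
Proof.
move=> gP; elim: (index_enum I) => [|i l [B [C [C0 gE]]]].
  by exists 0, 0; split=> // t; rewrite !big_nil !mulr0 !addr0.
have [B' [C' [C'0 gE']]] := gP i.
exists (B + B'), (C + C'); split=> [|t]; first exact: addr_ge0.
rewrite !big_cons gE gE'; ring.
Qed.

(** Move to the side where the linear term is nonnegative; the square term is nonnegative on both
    sides. *)
Lemma quad_convex_endpoint (g : R -> R) a b :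
  quad_convex g -> 0 <= a -> 0 <= b -> g 0 <= g a \/ g 0 <= g (- b).
Proof.
move=> [B [C [C0 gE]]] a0 b0; case: (lerP 0 B) => B0; [left; rewrite (gE a)|
  right; rewrite (gE (- b))]; rewrite -addrA lerDl.
  by rewrite addr_ge0 ?mulr_ge0 ?exprn_ge0.
apply: addr_ge0; last by rewrite mulr_ge0 ?sqr_ge0.
by rewrite mulNr -mulrN mulr_ge0 // oppr_ge0 ltW.
Qed.

(** One family for both rounding moves: for [u != v], [c = 1] trades mass between [u] and [v] at
    constant sum; [c = 0] changes [u] alone. *)
Definition shift u v (c t : R) x : V -> R :=
  fun w => x w + t * ((w == u)%:R - c * (w == v)%:R).

Definition indic (S : {set V}) : V -> R := fun w => (w \in S)%:R.


Lemma sum_shift u v c t x :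
  \sum_w shift u v c t x w = \sum_w x w + t * (1 - c).
Proof.
rewrite big_split /= -mulr_sumr sumrB -mulr_sumr.
have del1 z : \sum_(w : V) (w == z)%:R = 1 :> R.
  by rewrite (bigD1 z) //= eqxx big1 ?addr0 // => w /negPf ->.
by rewrite !del1 mulr1.
Qed.

(** Induction on the number of fractional coordinates: two of them trade mass until one is integral;
    a single remaining one is rounded. *)
Lemma pipage (G : (V -> R) -> R) (k : nat) :
  (forall x y, x =1 y -> G x = G y) ->
  (forall x u v c, (u != v) || (c == 0) -> (forall w, 0 <= x w <= 1) ->
     0 <= c -> quad_convex (fun t => G (shift u v c t x))) ->
  forall x, (forall w, 0 <= x w <= 1) -> \sum_w x w <= k%:R ->
  exists2 S : {set V}, (#|S| <= k)%N & G x <= G (indic S).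
Proof.
move=> Gext Gcvx x.
pose frac x := [set w : V | (x w != 0) && (x w != 1 :> R)].
have [n] := ubnP #|frac x|.
have shift0 u v c y : G y = G (shift u v c 0 y).
  by apply: Gext => w; rewrite /shift mul0r addr0.
elim: n x => // n IHn x ltDn x01 sumx.
have integral w : w \notin frac x -> x w = (x w == 1)%:R.
  by rewrite inE negb_and !negbK => /orP[] /eqP ->;
     rewrite ?eqxx // eq_sym oner_eq0.
(* A move inside the cube that does not lower [G] and makes [u] or [v] integral shrinks [frac x], so
   the induction hypothesis applies. *)
have move_to u v c t : u \in frac x -> v \in frac x ->
    (u != v) || (c == 0) ->
    0 <= x u + t <= 1 -> 0 <= x v - t * c <= 1 ->
    t * (1 - c) + \sum_w x w <= k%:R ->
    [|| x u + t == 0, x u + t == 1, (c == 1) && (x v - t * c == 0) |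
        (c == 1) && (x v - t * c == 1)] ->
    G x <= G (shift u v c t x) ->
    exists2 S : {set V}, (#|S| <= k)%N & G x <= G (indic S).
  move=> uD vD uvc xu01 xv01 sumk hit le_t.
  have yu : shift u v c t x u = x u + t.
    rewrite /shift eqxx; case/orP: uvc => [/negPf -> | /eqP ->].
      by rewrite mulr0 subr0 mulr1.
    by rewrite mul0r subr0 mulr1.
  have yv : u != v -> shift u v c t x v = x v - t * c.
    by rewrite /shift eqxx eq_sym => /negPf ->; rewrite mulr1 sub0r mulrN.
  have yw w : w != u -> (w != v) || (c == 0) -> shift u v c t x w = x w.
    rewrite /shift => /negPf -> /orP[/negPf -> | /eqP ->].
      by rewrite mulr0 subr0 mulr0 addr0.
    by rewrite mul0r subr0 mulr0 addr0.
  have [S Sk leS] : exists2 S : {set V}, (#|S| <= k)%N &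
      G (shift u v c t x) <= G (indic S); last first.
    by exists S => //; apply: le_trans leS.
  apply: IHn.
  - apply: (@leq_trans #|frac x|); last by rewrite -ltnS.
    apply: proper_card; apply/properP; split.
      apply/subsetP=> w; apply: contraTT => wD.
      have wu : w != u by apply: contraNneq wD => ->.
      have wv : w != v by apply: contraNneq wD => ->.
      by move: wD; rewrite !inE yw ?wv.
    have [c1|c1] := eqVneq c 1; last first.
      exists u => //; rewrite inE yu negb_and !negbK.
      by move: hit; rewrite (negPf c1) /= orbF.
    have uv : u != v by move: uvc; rewrite c1 oner_eq0 orbF.
    move: hit; rewrite {1 3}c1 eqxx /= orbA => /orP[hit|hit].
      by exists u => //; rewrite inE yu negb_and !negbK.
    by exists v => //; rewrite inE yv // negb_and !negbK.
  - move=> w; have [->|wu] := eqVneq w u; first by rewrite yu.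
    case: (boolP ((w != v) || (c == 0))) => [wv|]; first by rewrite yw.
    rewrite negb_or negbK => /andP[/eqP wv _].
    by rewrite wv yv // -wv eq_sym.
  - by rewrite sum_shift addrC.
have [D0|] := eqVneq (frac x) set0.
  have xE : x =1 indic [set w | x w == 1].
    by move=> w; rewrite /indic inE [LHS]integral // D0 inE.
  exists [set w | x w == 1]; last by rewrite (Gext _ _ xE).
  move: sumx; rewrite (eq_bigr _ (fun w _ => xE w)) -natr_sum ler_nat.
  by rewrite -big_mkcond /= sum1_card.
case/set0Pn => u uD.
have xu := x01 u.
have [Du|] := eqVneq (frac x :\ u) set0.
  (* The other coordinates sum to an integer, so [x u] can be rounded up. *)
  have le1 : \sum_w x w + (1 - x u) <= k%:R.
    have othersE : \sum_w x w - x u = #|[set w | (w != u) && (x w == 1)]|%:R.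
      rewrite (bigD1 u) //= [x u + _]addrC addrK -sum1_card natr_sum.
      rewrite [RHS](eq_bigl (fun w => (w != u) && (x w == 1))); last first.
        by move=> w; rewrite inE.
      rewrite [RHS]big_mkcondr; apply: eq_bigr => w wu.
      rewrite [LHS]integral; first by case: (x w == 1).
      by have := in_set0 w; rewrite -Du in_setD1 wu => /negbT.
    have -> : \sum_w x w + (1 - x u) = (#|[set w | (w != u) && (x w == 1)]|.+1)%:R.
      by rewrite -natr1 -othersE; ring.
    (* Since [0 < x u], the integer sum of the other coordinates is strictly below [k]. *)
    rewrite ler_nat -(ltr_nat R) -othersE.
    have : 0 < x u by rewrite lt0r; move: uD; rewrite inE => /andP[-> _]; case/andP: xu.
    lra.
  have c0 : (u != u) || (0 == 0 :> R) by rewrite !eqxx.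
  have := quad_convex_endpoint (Gcvx x u u 0 c0 x01 (lexx _))
    (_ : 0 <= 1 - x u) (_ : 0 <= x u).
  rewrite -shift0 => /(_ ltac:(lra) ltac:(lra)) [] leG.
    by apply: (move_to u u 0 (1 - x u)) => //; lra.
  by apply: (move_to u u 0 (- x u)) => //; lra.
case/set0Pn => v; rewrite in_setD1 => /andP[vu vD].
have xv := x01 v.
have uv : (u != v) || (1 == 0 :> R) by rewrite eq_sym vu.
(* Both step lengths are the largest that stay in the cube, so at either end [u] or [v] hits [0] or
   [1]. *)
have := quad_convex_endpoint (Gcvx x u v 1 uv x01 ler01)
  (_ : 0 <= Num.min (1 - x u) (x v)) (_ : 0 <= Num.min (x u) (1 - x v)).
rewrite -shift0 !le_min.
move=> /(_ ltac:(apply/andP; lra) ltac:(apply/andP; lra)) [] leG.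
  by apply: (move_to u v 1 _ uD vD uv _ _ _ _ leG); rewrite ?eqxx /=;
     case: (lerP (1 - x u) (x v)) => h; lra.
by apply: (move_to u v 1 _ uD vD uv _ _ _ _ leG); rewrite ?eqxx /=;
   case: (lerP (x u) (1 - x v)) => h; lra.
Qed.

End PipageRounding.

(** * Reach probability along a root path under independent seeding *)

Section ChainReach.
Variables (R : realFieldType) (V : finType) (r : V -> R).
Hypothesis r01 : forall v, 0 <= r v <= 1.
Implicit Types (x y : V -> R) (s : seq V).

(* [s] is a path read downwards from the root; [r v] is the probability of the
   edge entering [v]. *)
Definition chain_reach x s : R :=
  foldl (fun acc v => x v + (1 - x v) * (r v * acc)) 0 s.

Lemma chain_reach_rcons x s v :
  chain_reach x (rcons s v) = x v + (1 - x v) * (r v * chain_reach x s).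
Proof. by rewrite /chain_reach foldl_rcons. Qed.

Lemma chain_reach01 x s :
  (forall v, 0 <= x v <= 1) -> 0 <= chain_reach x s <= 1.
Proof.
move=> x01; elim/last_ind: s => [|s v IH]; first by rewrite lexx ler01.
rewrite chain_reach_rcons; have := x01 v; have := r01 v.
move: (x v) (r v) (chain_reach x s) IH => a b c /andP[c0 c1] /andP[b0 b1] a01.
have bc0 : 0 <= b * c by rewrite mulr_ge0.
have bc1 : b * c <= 1 by rewrite mulr_ile1.
by nra.
Qed.

Lemma eq_chain_reach x y s : {in s, x =1 y} -> chain_reach x s = chain_reach y s.
Proof.
elim/last_ind: s => // s v IH xy; rewrite !chain_reach_rcons xy ?IH //.
  by move=> w ws; apply: xy; rewrite mem_rcons inE ws orbT.
by rewrite mem_rcons mem_head.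
Qed.

(** Without repetitions in [s], coordinate [v] enters at most once, hence degree one. As [y] is
    constrained on [s] only, a [shift] that also moves a node outside [s] qualifies. *)
Lemma chain_reach_affine x s v :
  (forall w, 0 <= x w <= 1) -> uniq s ->
  exists2 B : R, 0 <= B &
    forall t y, {in s, forall w, y w = x w + t * (w == v)%:R} ->
    chain_reach y s = chain_reach x s + t * B.
Proof.
move=> x01; elim/last_ind: s => [|s w IH].
  by exists 0 => // t y _; rewrite mulr0 addr0.
rewrite rcons_uniq => /andP[ws us]; have [B B0 BE] := IH us.
have xw := x01 w; have rw := r01 w; have cs := chain_reach01 s x01.
have sub t y : {in rcons s w, forall z, y z = x z + t * (z == v)%:R} ->
    {in s, forall z, y z = x z + t * (z == v)%:R}.
  by move=> yE z zs; apply: yE; rewrite mem_rcons inE zs orbT.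
have [wv|wv] := eqVneq w v.
  exists (1 - r w * chain_reach x s) => [|t y yE].
    by rewrite subr_ge0 mulr_ile1 //; lra.
  rewrite !chain_reach_rcons.
  have -> : chain_reach y s = chain_reach x s.
    apply: eq_chain_reach => z zs; rewrite (sub _ _ yE) // (_ : z == v = false).
      by rewrite mulr0 addr0.
    by apply: contraNF ws => /eqP zv; rewrite wv -zv.
  rewrite yE ?mem_rcons ?mem_head // wv eqxx /=; ring.
exists ((1 - x w) * (r w * B)) => [|t y yE].
  by rewrite !mulr_ge0 ?subr_ge0 //; lra.
rewrite !chain_reach_rcons (BE _ _ (sub _ _ yE)).
rewrite yE ?mem_rcons ?mem_head // (negPf wv) /=; ring.
Qed.

(* Raising [x u] lowers the weight [1 - x u] of everything above [u], so the
   mixed second derivatives are nonpositive. *)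
Lemma chain_reach_convex x s u v c :
  uniq s -> (u != v) || (c == 0) -> (forall w, 0 <= x w <= 1) -> 0 <= c ->
  quad_convex (fun t => chain_reach (shift u v c t x) s).
Proof.
move=> us uvc x01 c0.
(* The constant term is [chain_reach x s] because [shift u v c 0 x] equals [x] only pointwise. *)
suff [B [C [C0 BCE]]] : exists B C : R, 0 <= C /\ forall t,
    chain_reach (shift u v c t x) s = chain_reach x s + t * B + t ^+ 2 * C.
  by exists B, C; split=> // t; rewrite (BCE t) (BCE 0); ring.
elim/last_ind: s us => [|s w IH].
  by exists 0, 0; split=> // t; rewrite !mulr0 !addr0.
rewrite rcons_uniq => /andP[ws us]; have [B [C [C0 BCE]]] := IH us.
have xw := x01 w; have rw := r01 w.
have notin z : z \in s -> z == w = false.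
  by move=> zs; apply: contraNF ws => /eqP <-.
have [wu|wu] := eqVneq w u.
  (* The factor [1 - x u - t] meets a prefix of slope [- (c * B')] in [t]; the two minus signs
     cancel in the square term. *)
  have [B' B'0 B'E] := chain_reach_affine v x01 us.
  exists (1 - r w * chain_reach x s - (1 - x w) * (r w * (c * B'))),
    (r w * (c * B')); split=> [|t]; first by rewrite !mulr_ge0 //; case/andP: rw.
  rewrite !chain_reach_rcons (B'E (- (t * c))).
    rewrite /shift wu eqxx.
    have -> : c * (u == v)%:R = 0.
      by case/orP: uvc => [/negPf ->|/eqP ->]; rewrite ?mulr0 ?mul0r.
    rewrite /=; ring.
  by move=> z zs; rewrite /shift -wu notin //=; ring.
have [wv|wv] := eqVneq w v.
  have [B' B'0 B'E] := chain_reach_affine u x01 us.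
  exists (- c * (1 - r w * chain_reach x s) + (1 - x w) * (r w * B')),
    (r w * (c * B')); split=> [|t]; first by rewrite !mulr_ge0 //; case/andP: rw.
  rewrite !chain_reach_rcons (B'E t).
    by rewrite /shift (negPf wu) wv eqxx /=; ring.
  by move=> z zs; rewrite /shift -wv notin //=; ring.
exists ((1 - x w) * (r w * B)), ((1 - x w) * (r w * C)); split=> [|t].
  by rewrite !mulr_ge0 ?subr_ge0 //; lra.
by rewrite !chain_reach_rcons BCE /shift (negPf wu) (negPf wv) /=; ring.
Qed.

End ChainReach.

(** * Live-edge measure, reachability and adaptive runs *)

Section Cascade.
Variables (R : realFieldType) (V : finType) (E : {set V * V}) (p : V -> V -> R).
Hypothesis p01 : forall u v, (u, v) \in E -> 0 <= p u v <= 1.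
Implicit Types (phi : {set V * V}) (S : {set V}) (pi : policy V).

Definition Pr (A : pred {set V * V}) : R := expect E p (fun phi => (A phi)%:R).

Lemma realization_prob_ge0 phi : 0 <= realization_prob E p phi.
Proof.
apply: prodr_ge0 => -[u v] /p01 /= uv01.
by case: ifP => _; lra.
Qed.

Lemma realization_prob_sum1 :
  \sum_(phi : {set V * V} | phi \subset E) realization_prob E p phi = 1.
Proof.
(* Expanding the product of all [F e + G e = 1] gives one term per edge set; the padding [0] in [F]
   kills the sets not inside [E]. *)
pose F e := if e \in E then p e.1 e.2 else 0.
pose G e := if e \in E then 1 - p e.1 e.2 else 1.
have FG : \prod_e (F e + G e) = 1.
  by apply: big1 => e _; rewrite /F /G; case: ifP => _; ring.
rewrite -[RHS]FG bigA_distr [RHS](bigID (fun phi => phi \subset E)) /=.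
rewrite [X in _ = _ + X]big1 ?addr0 => [|phi /subsetPn[e ephi eE]]; last first.
  by rewrite (bigD1 e) //= ephi /F (negPf eE) mul0r.
apply: eq_big => // phi phiE; rewrite /realization_prob.
rewrite [RHS](bigID (mem E)) /= [X in _ = _ * X]big1 ?mulr1.
  by apply: eq_bigr => e eE; rewrite /F /G eE.
move=> e eE; rewrite (negPf (contraNN (subsetP phiE e) eE)).
by rewrite /G (negPf eE).
Qed.

Lemma expect_sum (I : finType) (f : I -> {set V * V} -> R) :
  expect E p (fun phi => \sum_i f i phi) = \sum_i expect E p (f i).
Proof.
rewrite /expect exchange_big; apply: eq_bigr => phi _; exact: mulr_sumr.
Qed.

Lemma expect_le f g : (forall phi, phi \subset E -> f phi <= g phi) ->
  expect E p f <= expect E p g.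
Proof.
move=> fg; apply: ler_sum => phi /fg; apply: ler_wpM2l.
exact: realization_prob_ge0.
Qed.

Lemma expectD f g :
  expect E p (fun phi => f phi + g phi) = expect E p f + expect E p g.
Proof. by rewrite /expect -big_split; apply: eq_bigr => phi _; exact: mulrDr. Qed.

Lemma expect_const a : expect E p (fun=> a) = a.
Proof. by rewrite /expect -mulr_suml realization_prob_sum1 mul1r. Qed.

Lemma Pr_ge0 A : 0 <= Pr A.
Proof. by apply: sumr_ge0 => phi _; rewrite mulr_ge0 ?realization_prob_ge0. Qed.

Lemma Pr_le1 A : Pr A <= 1.
Proof. by rewrite -(expect_const 1); apply: expect_le => phi _; rewrite lern1 leq_b1. Qed.

Lemma eq_Pr A B : (forall phi, phi \subset E -> A phi = B phi) -> Pr A = Pr B.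
Proof. by move=> AB; apply: eq_bigr => phi /AB ->. Qed.

(** Realizations are paired as [phi] and [e |: phi]; an event blind to [e] takes the same value on
    both, so the weight of [e] factors out. *)
Lemma Pr_indep_edge e (A : pred {set V * V}) : e \in E ->
  (forall phi, A (e |: phi) = A phi) ->
  Pr (fun phi => A phi && (e \in phi)) = p e.1 e.2 * Pr A.
Proof.
move=> eE Ae.
have split g : expect E p g =
    \sum_(phi : {set V * V} | (phi \subset E) && (e \notin phi))
      (realization_prob E p phi * g phi +
       realization_prob E p (e |: phi) * g (e |: phi)).
  rewrite /expect (bigID (fun phi => e \in phi)) /= addrC big_split /=.
  congr (_ + _).
  rewrite (reindex_onto (fun phi => e |: phi) (fun phi => phi :\ e)) /=.
    apply: eq_bigl => phi; rewrite subUset sub1set eE setU11 andbT /=.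
    case: (boolP (e \in phi)) => ephi; last by rewrite setU1K ?eqxx.
    rewrite !andbF; apply/andP => -[_ /eqP phiE].
    by move: ephi; rewrite -phiE !inE eqxx.
  by move=> phi /andP[_ ephi]; rewrite setD1K.
rewrite /Pr !split mulr_sumr; apply: eq_bigr => phi /andP[phiE ephi].
rewrite Ae (negPf ephi) setU11 andbF andbT mulr0 add0r -mulrDl mulrA.
congr (_ * _); rewrite /realization_prob !(bigD1 e eE) /= setU11 (negPf ephi).
rewrite (eq_bigr (fun e' => if e' \in phi then p e'.1 e'.2 else 1 - p e'.1 e'.2)).
  by ring.
by move=> e' /andP[_ /negPf e'e]; rewrite in_setU1 e'e.
Qed.

Lemma sub_reach S phi : S \subset reach S phi.
Proof.
by apply/subsetP => v vS; rewrite inE; apply/existsP; exists v; rewrite vS connect0.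
Qed.

Lemma reach_mono S S' phi phi' : S \subset S' -> phi \subset phi' ->
  reach S phi \subset reach S' phi'.
Proof.
move=> SS pp; apply/subsetP => v; rewrite !inE => /existsP[s /andP[sS sv]].
apply/existsP; exists s; rewrite (subsetP SS) //=.
apply: connect_sub sv => a b ab; apply: connect1.
exact: (subsetP pp).
Qed.

Lemma reach_step S phi u v :
  u \in reach S phi -> (u, v) \in phi -> v \in reach S phi.
Proof.
rewrite !inE => /existsP[s /andP[sS su]] uv; apply/existsP; exists s.
by rewrite sS (connect_trans su) // connect1.
Qed.

Lemma reachP S phi v : reflect (v \in S \/ exists2 u, u \in reach S phi & (u, v) \in phi)
  (v \in reach S phi).
Proof.
apply: (iffP idP) => [|[/(subsetP (sub_reach _ _)) //|[u]]]; last exact: reach_step.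
rewrite inE => /existsP[s /andP[sS /connectP[q]]].
elim/last_ind: q v => [|q w _] v /=; first by move=> _ ->; left.
rewrite rcons_path last_rcons => /andP[sq qw] ->; right.
exists (last s q) => //; rewrite inE; apply/existsP; exists s.
by rewrite sS; apply/connectP; exists q.
Qed.

Lemma reach_closed S phi (C : {set V}) : S \subset C ->
  (forall u v, u \in C -> (u, v) \in phi -> v \in C) -> reach S phi \subset C.
Proof.
move=> SC Cstep; apply/subsetP => v; rewrite inE => /existsP[s /andP[sS]].
case/connectP => q; elim/last_ind: q v => [|q w IH] v /=.
  by move=> _ ->; exact: (subsetP SC).
rewrite rcons_path last_rcons => /andP[sq qw] ->.
exact: Cstep (IH _ sq erefl) qw.
Qed.

(* An out-edge of an unreached node influences neither the reached set nor the
   feedback. *)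
Lemma reach_setU1 S phi u v : u \notin reach S phi ->
  reach S ((u, v) |: phi) = reach S phi.
Proof.
move=> uS; apply/eqP; rewrite eqEsubset [X in _ && X]reach_mono ?subsetU1 // andbT.
apply: reach_closed (sub_reach _ _) _ => a b aS.
rewrite in_setU1 => /predU1P[[au _]|]; last exact: reach_step.
by rewrite -au aS in uS.
Qed.

Lemma mem_reach_setU1 S phi u v :
  (u \in reach S ((u, v) |: phi)) = (u \in reach S phi).
Proof.
case: (boolP (u \in reach S phi)) => [|uS]; last by rewrite reach_setU1 // (negPf uS).
by apply: subsetP; rewrite reach_mono ?subsetU1.
Qed.

Lemma observed_live_setU1 S phi u v : u \notin reach S phi ->
  observed_live S ((u, v) |: phi) = observed_live S phi.
Proof.
move=> uS; apply/setP => -[a b]; rewrite [LHS]inE [RHS]inE /= in_setU1 reach_setU1 //.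
have [[-> _]|//] := (a, b) =P (u, v).
by rewrite (negPf uS) !andbF.
Qed.

(** The runs under both realizations coincide until [u] is reached, as the feedback agrees. From
    then on [u] stays reached in both, since seeds only accumulate. *)
Lemma mem_reach_policy_setU1 pi phi u v :
  (u \in reach (policy_seeds pi ((u, v) |: phi)) ((u, v) |: phi)) =
  (u \in reach (policy_seeds pi phi) phi).
Proof.
rewrite /policy_seeds; set phi' := (u, v) |: phi.
pose T n := iter n (policy_step pi phi) set0.
pose T' n := iter n (policy_step pi phi') set0.
have step psi S w : w \in reach S psi -> w \in reach (policy_step pi psi S) psi.
  apply: subsetP; apply: reach_mono => //.
  by rewrite /policy_step; case: (pi _ _) => [z|//]; exact: subsetU1.
suff [| [] ]: T #|V| = T' #|V| \/ u \in reach (T #|V|) phi /\ u \in reach (T' #|V|) phi'.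
- by rewrite /T /T' => ->; rewrite mem_reach_setU1.
- by rewrite /T /T' => -> ->.
elim: #|V| => [|n [TE|[uT uT']]]; first by left.
  have [uT|uT] := boolP (u \in reach (T n) phi).
    right; split; first exact: (step _ (T n)).
    by apply: (step _ (T' n)); rewrite -TE mem_reach_setU1.
  left; rewrite /T /T' !iterS -/(T n) -/(T' n) -TE /policy_step.
  by rewrite observed_live_setU1.
by right; split; [apply: (step _ (T n))|apply: (step _ (T' n))].
Qed.

Definition seed_prob pi v : R := Pr (fun phi => v \in policy_seeds pi phi).
Definition policy_reach_prob pi v : R :=
  Pr (fun phi => v \in reach (policy_seeds pi phi) phi).
Definition reach_prob S v : R := Pr (fun phi => v \in reach S phi).

Lemma natr_card (A : {set V}) : #|A|%:R = \sum_v (v \in A)%:R :> R.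
Proof. by rewrite -sum1_card natr_sum big_mkcond /=; apply: eq_bigr => v _; case: ifP. Qed.

Lemma sigmaE S : sigma E p S = \sum_v reach_prob S v.
Proof.
by rewrite -expect_sum; apply: eq_bigr => phi _; rewrite natr_card.
Qed.

Lemma sigma_polE pi : sigma_pol E p pi = \sum_v policy_reach_prob pi v.
Proof.
by rewrite -expect_sum; apply: eq_bigr => phi _; rewrite natr_card.
Qed.

Lemma sum_seed_prob k pi : policy_in k E pi -> \sum_v seed_prob pi v <= k%:R.
Proof.
move=> pik; rewrite -expect_sum -(expect_const k%:R); apply: expect_le => phi phiE.
by rewrite -natr_card ler_nat pik.
Qed.

(** With unique parents the sum has at most one term; it depends on [v] alone and is [0] when no
    edge enters [v]. *)
Definition in_prob v : R := \sum_(u | (u, v) \in E) p u v.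

(** * Recursions from parent to child *)

Section Tree.
Hypothesis unique_parent : forall v, (#|[set u | (u, v) \in E]| <= 1)%N.

Lemma parent_inj u u' v : (u, v) \in E -> (u', v) \in E -> u' = u.
Proof.
move=> uv u'v; have /card_le1_eqP := unique_parent v.
by apply; rewrite inE.
Qed.

Lemma in_probE u v : (u, v) \in E -> in_prob v = p u v.
Proof.
move=> uv; rewrite /in_prob (big_pred1 u) // => u' /=.
by apply/idP/eqP => [/(parent_inj uv)|->].
Qed.

Lemma in_prob01 v : 0 <= in_prob v <= 1.
Proof.
have [u uv|noE] := pickP (fun u => (u, v) \in E); first by rewrite (in_probE uv) p01.
by rewrite /in_prob big_pred0 // lexx ler01.
Qed.

(** Union bound: [v] is seeded, or [u] is reached and the edge is live; the latter two are
    independent even for an adaptive policy. *)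
Lemma policy_reach_prob_le pi u v : (u, v) \in E ->
  policy_reach_prob pi v <= seed_prob pi v + in_prob v * policy_reach_prob pi u.
Proof.
move=> uv; rewrite (in_probE uv) -(Pr_indep_edge uv); last first.
  by move=> phi; rewrite mem_reach_policy_setU1.
rewrite -expectD; apply: expect_le => phi phiE; rewrite -natrD ler_nat.
case: reachP => [[-> //|[u' u'S u'v]]|//].
by rewrite -(parent_inj uv (subsetP phiE _ u'v)) u'S u'v addn1.
Qed.

Lemma reach_prob_seed S v : v \in S -> reach_prob S v = 1.
Proof.
move=> vS; rewrite -(expect_const 1); apply: eq_bigr => phi _.
by rewrite (subsetP (sub_reach S phi)).
Qed.

Lemma reach_prob_edge S u v : (u, v) \in E -> v \notin S ->
  reach_prob S v = in_prob v * reach_prob S u.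
Proof.
move=> uv vS; rewrite (in_probE uv) -(Pr_indep_edge uv); last first.
  by move=> phi; rewrite mem_reach_setU1.
apply: eq_Pr => phi phiE; apply/reachP/andP => [[vS'|[u' u'S u'v]]|[uS uv']].
- by rewrite vS' in vS.
- by rewrite -(parent_inj uv (subsetP phiE _ u'v)).
- by right; exists u.
Qed.

Lemma seed_prob01 pi v : 0 <= seed_prob pi v <= 1.
Proof. by rewrite Pr_ge0 Pr_le1. Qed.

Variable root : V.
Hypothesis root_min : forall u, (u, root) \notin E.
Notation edge := [rel u v | (u, v) \in E].

(** At 0/1 seeding probabilities both sides obey the same recursion: a seed resets the value to [1],
    any other node multiplies its parent's value by [in_prob]. *)
Lemma chain_reach_indic S q : path edge root q ->
  chain_reach in_prob (indic R S) (root :: q) <= reach_prob S (last root q).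
Proof.
elim/last_ind: q => [_|q v IH].
  rewrite /chain_reach /= !mulr0 addr0 /indic; case: (boolP (root \in S)) => rS.
    by rewrite reach_prob_seed.
  exact: Pr_ge0.
rewrite rcons_path last_rcons -rcons_cons chain_reach_rcons => /andP[/IH IHq qv].
rewrite /indic; case: (boolP (v \in S)) => vS.
  by rewrite reach_prob_seed // subrr mul0r addr0.
rewrite subr0 mul1r add0r (reach_prob_edge qv vS).
by apply: ler_wpM2l => //; case/andP: (in_prob01 v).
Qed.

(* With [x] the seeding probability of [v] and [P] the probability that its
   in-edge is live and its parent reached, the induction step is
   [2 x + (1 - x) P >= min 1 (x + P)], which holds as [x (1 - P) >= 0]. *)
Lemma policy_reach_prob_chain pi q : path edge root q ->
  policy_reach_prob pi (last root q) <=
  2 * chain_reach in_prob (seed_prob pi) (root :: q).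
Proof.
elim/last_ind: q => [_|q v IH].
  (* No edge enters the root, so it is reached only as a seed. *)
  rewrite /chain_reach /= !mulr0 addr0; apply: (@le_trans _ _ (seed_prob pi root)).
    apply: expect_le => phi phiE; rewrite ler_nat.
    case: reachP => [[->|[u _ /(subsetP phiE)]]|//] //.
    by rewrite (negPf (root_min u)).
  by have /andP[? _] := seed_prob01 pi root; lra.
rewrite rcons_path last_rcons -rcons_cons chain_reach_rcons => /andP[/IH IHq qv].
have := policy_reach_prob_le pi qv.
have /andP[x0 x1] := seed_prob01 pi v.
have /andP[r0 r1] := in_prob01 v.
have /andP[f0 f1] := chain_reach01 in_prob01 (root :: q) (seed_prob01 pi).
have P0 : 0 <= policy_reach_prob pi (last root q) := Pr_ge0 _.
have P1 : policy_reach_prob pi (last root q) <= 1 := Pr_le1 _.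
move: (policy_reach_prob pi v) (policy_reach_prob pi _) (seed_prob pi v)
  (in_prob v) (chain_reach _ _ _) IHq x0 x1 r0 r1 f0 f1 P0 P1.
move=> Pv P x r F PF x0 x1 r0 r1 f0 f1 P0 P1 PvP.
have rP : r * P <= 2 * (r * F) by rewrite mulrCA ler_wpM2l.
have rP1 : r * P <= 1 by rewrite mulr_ile1.
have := ler_wpM2l (_ : 0 <= 1 - x) rP; rewrite subr_ge0 => /(_ x1).
have : 0 <= x * (1 - r * P) by rewrite mulr_ge0 ?subr_ge0.
lra.
Qed.

End Tree.
End Cascade.

(* sup_{G out-arborescence, k >= 1} OPT_A(G,k)/OPT_N(G,k) <= 2, stated as:
   every adaptive policy in Pi(k) has sigma(pi) <= 2 * OPT_N(G,k). *)
Theorem theorem2 (R : realFieldType) (V : finType) (E : {set V * V})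
    (p : V -> V -> R) :
  (forall u v, (u, v) \in E -> 0 <= p u v <= 1) ->
  out_arborescence E ->
  forall (k : nat), (1 <= k)%N ->
  forall pi : policy V, policy_in k E pi ->
  sigma_pol E p pi <= 2 * OPT_N E p k.
Proof.
move=> p01 [root [rootE parentE rootC]] k _ pi pik.
have parent1 v : (#|[set u | (u, v) \in E]| <= 1)%N.
  have [->|/parentE -> //] := eqVneq v root.
  by rewrite (_ : [set _ | _] = set0) ?cards0 //; apply/setP=> u; rewrite !inE (negPf (rootE u)).
have chainP v : exists q : seq V, [&& path [rel u v | (u, v) \in E] root q,
    uniq (root :: q) & last root q == v].
  by case/connectP: (rootC v) => q /shortenP[q' rq' uq' _] ->; exists q'; rewrite rq' uq' eqxx.
pose chain v := xchoose (chainP v).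
have rin := in_prob01 p01 parent1.
(* [G] is the multilinear extension of [sigma]: the expected spread when each [w] is seeded
   independently with probability [x w]. *)
pose G x := \sum_v chain_reach (in_prob E p) x (root :: chain v).
have [||S Sk leG] := @pipage R V G k _ _ (seed_prob E p pi)
    (seed_prob01 p01 pi) (sum_seed_prob p01 pik).
- by move=> x y xy; apply: eq_bigr => v _; apply: eq_chain_reach => w _.
- move=> x u v c uvc x01 c0; apply: quad_convex_sum => w.
  by apply: chain_reach_convex => //; case/and3P: (xchooseP (chainP w)).
(* The factor [2] is lost here, node by node; the rounding to [S] loses nothing. *)
apply: (@le_trans _ _ (2 * G (seed_prob E p pi))).
  rewrite sigma_polE mulr_sumr; apply: ler_sum => v _.
  have /and3P[rq _ /eqP qv] := xchooseP (chainP v).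
  by rewrite -{1}qv policy_reach_prob_chain.
rewrite ler_wpM2l //; apply: le_trans leG _.
apply: le_trans (le_bigmax_cond _ _ Sk); rewrite sigmaE; apply: ler_sum => v _.
have /and3P[rq _ /eqP qv] := xchooseP (chainP v).
by rewrite -[X in _ <= reach_prob _ _ _ X]qv chain_reach_indic.
Qed.
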